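(* Let $G$ be a finitely generated LPF group with $\nabla G>0$, and let $A,B$ be finitely generated subgroups of infinite index in $G$. Then there is a finite index subgroup $B_0\le B$ such that $[G:\langle A\cup B_0\rangle]=\infty$.
   Context: For a group $U$, $d(U)$ denotes the minimal cardinality of a generating set of $U$. The rank gradient of a finitely generated group $G$ is $\nabla G=\inf_U \frac{d(U)-1}{[G:U]}$, where $U$ ranges over all finite index subgroups of $G$. The proindex of a subgroup $H$ in $G$ is the supremum of the indices $[G:U]$ over finite index subgroups $U$ of $G$ containing $H$. A group $G$ is LPF if for every finitely generated subgroup of $G$ its index and proindex in $G$ coincide. *)

(* Defs.v *)
From Stdlib Require Import Reals List Arith.
Import ListNotations.
Set Implicit Arguments.
Unset Strict Implicit.
Open Scope R_scope.

Record group := Group {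
  carrier :> Type;
  mul : carrier -> carrier -> carrier;
  one : carrier;
  inv : carrier -> carrier;
  mulA : forall x y z, mul x (mul y z) = mul (mul x y) z;
  mul1g : forall x, mul one x = x;
  mulVg : forall x, mul (inv x) x = one
}.
Arguments mul {g}. Arguments one {g}. Arguments inv {g}.

Definition subset (G : group) (P Q : G -> Prop) : Prop := forall x, P x -> Q x.

Definition is_subgroup (G : group) (H : G -> Prop) : Prop :=
  H one /\ (forall x y, H x -> H y -> H (mul x y)) /\ (forall x, H x -> H (inv x)).

Definition gen (G : group) (S : G -> Prop) : G -> Prop :=
  fun x => forall H : G -> Prop, is_subgroup H -> subset S H -> H x.

Definition generated_by (G : group) (H : G -> Prop) (l : list G) : Prop :=
  forall x, H x <-> gen (fun y => In y l) x.

Definition fin_gen (G : group) (H : G -> Prop) : Prop :=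
  exists l : list G, generated_by H l.

Definition rank (G : group) (H : G -> Prop) (d : nat) : Prop :=
  (exists l : list G, length l = d /\ generated_by H l) /\
  (forall l : list G, generated_by H l -> (d <= length l)%nat).

(* [K : H] = n  (H a subgroup of K): a list of n representatives of the
   distinct left cosets gH (g in K) covering K. *)
Definition index_in (G : group) (K H : G -> Prop) (n : nat) : Prop :=
  exists l : list G, length l = n /\
    (forall g, In g l -> K g) /\
    (forall x, K x -> exists g, In g l /\ H (mul (inv g) x)) /\
    (forall i j, (i < n)%nat -> (j < n)%nat ->
        H (mul (inv (nth i l one)) (nth j l one)) -> i = j).

Definition finite_index_in (G : group) (K H : G -> Prop) : Prop :=
  exists n, index_in K H n.

Definition index (G : group) (H : G -> Prop) (n : nat) : Prop :=
  index_in (fun _ => True) H n.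

Definition finite_index (G : group) (H : G -> Prop) : Prop :=
  exists n, index H n.

(* index and proindex as values in N ∪ {∞}; None stands for ∞ *)
Definition has_index (G : group) (H : G -> Prop) (i : option nat) : Prop :=
  match i with
  | Some n => index H n
  | None => ~ finite_index H
  end.

Definition has_proindex (G : group) (H : G -> Prop) (i : option nat) : Prop :=
  match i with
  | Some n =>
      (exists U : G -> Prop, is_subgroup U /\ subset H U /\ index U n) /\
      (forall (U : G -> Prop) m, is_subgroup U -> subset H U -> index U m -> (m <= n)%nat)
  | None =>
      forall m : nat, exists (U : G -> Prop) k, is_subgroup U /\ subset H U /\ index U k /\ (m <= k)%nat
  end.

Definition LPF (G : group) : Prop :=
  forall H : G -> Prop, is_subgroup H -> fin_gen H ->
    forall i : option nat, has_index H i <-> has_proindex H i.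

(* rank gradient > 0:  inf_U (d(U)-1)/[G:U] > 0, i.e. the infimum has a
   positive lower bound eps. *)
Definition rank_gradient_pos (G : group) : Prop :=
  exists eps : R, 0 < eps /\
    forall (U : G -> Prop) (n d : nat), is_subgroup U -> index U n -> rank U d ->
      eps <= (INR d - 1) / INR n.

(* Main.v *)
Require Import Defs.
From Stdlib Require Import Reals List Arith.
From Stdlib Require Import Lia Lra Classical ClassicalEpsilon.
From Stdlib Require Import FunctionalExtensionality PropExtensionality.

(** If [U >= A] and [V >= B] have large finite index, Schreier's bound on the
    number of generators shows that [C := <A ∩ V, B ∩ U>] needs few generators
    compared with [[G : U ∩ V]], so [C] has infinite index because the rank
    gradient is positive.  Hence [C] lies in subgroups [T] of arbitrarily large
    finite index [M].  Let [N] be the normal core of [T].  As [A N] is covered by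
    [[A : A ∩ V]] cosets of [(A ∩ V) N <= T], the index in [B] of
    [B1 := B ∩ U ∩ (A ∩ V) N] is at most a constant times [[G : A N] / M].
    So [<A, B1> <= A N] is again generated by few elements compared with its
    index, which is therefore infinite. *)

Local Open Scope nat_scope.

(** * Elementary group theory *)

Section GroupTheory.
Context {G : group}.
Implicit Types x y z : G.

Lemma mulKg x y : mul (inv x) (mul x y) = y.
Proof. now rewrite mulA, mulVg, mul1g. Qed.

Lemma mul_left_inj x y z : mul x y = mul x z -> y = z.
Proof. intro E. now rewrite <- (mulKg x y), E, mulKg. Qed.

Lemma mulgV x : mul x (inv x) = one.
Proof.
  apply (mul_left_inj (inv x)).
  rewrite mulA, mulVg, mul1g.
  apply (mul_left_inj (inv (inv x))). now rewrite mulKg, mulVg.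
Qed.

Lemma mulg1 x : mul x one = x.
Proof. now rewrite <- (mulVg x), mulA, mulgV, mul1g. Qed.

Lemma mulVKg x y : mul x (mul (inv x) y) = y.
Proof. now rewrite mulA, mulgV, mul1g. Qed.

Lemma invgK x : inv (inv x) = x.
Proof. apply (mul_left_inj (inv x)). now rewrite mulgV, mulVg. Qed.

Lemma inv_mul x y : inv (mul x y) = mul (inv y) (inv x).
Proof.
  apply (mul_left_inj (mul x y)).
  now rewrite mulgV, <- mulA, mulVKg, mulgV.
Qed.

Lemma inv_one : inv (one : G) = one.
Proof. now rewrite <- (mul1g (inv one)), mulgV. Qed.

End GroupTheory.

Ltac grp := repeat (rewrite ?inv_mul, ?invgK, ?inv_one, ?mul1g, ?mulg1,
  ?mulVg, ?mulgV, ?mulKg, ?mulVKg, <- ?mulA); try reflexivity.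

(** * Generated subgroups and products with a normal subgroup *)

Section Subgroups.
Context {G : group}.
Implicit Types (x y z : G) (H K L P N T : G -> Prop).

Lemma subgroup_full : is_subgroup (fun _ : G => True).
Proof. repeat split. Qed.

Lemma subgroup_inter H K :
  is_subgroup H -> is_subgroup K -> is_subgroup (fun x => H x /\ K x).
Proof. unfold is_subgroup. intuition. Qed.

Lemma subgroup_gen (S : G -> Prop) : is_subgroup (gen S).
Proof.
  split; [|split].
  - intros H HH _. apply HH.
  - intros x y Hx Hy H HH HS. apply HH; [now apply Hx | now apply Hy].
  - intros x Hx H HH HS. apply HH. now apply Hx.
Qed.

Lemma subset_gen (S : G -> Prop) : subset S (gen S).
Proof. intros x Hx H _ HS. now apply HS. Qed.

Lemma gen_union_generated_by H K (h k : list G) :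
  generated_by H h -> generated_by K k ->
  generated_by (gen (fun x => H x \/ K x)) (h ++ k).
Proof.
  intros Hh Hk x. split; intros Hx L HL HS; apply Hx; trivial; intros y Hy.
  - destruct Hy as [Hy|Hy].
    + apply Hh in Hy. apply Hy; trivial.
      intros z Hz. apply HS, in_or_app. now left.
    + apply Hk in Hy. apply Hy; trivial.
      intros z Hz. apply HS, in_or_app. now right.
  - apply HS. apply in_app_or in Hy. destruct Hy as [Hy|Hy].
    + left. apply Hh, subset_gen, Hy.
    + right. apply Hk, subset_gen, Hy.
Qed.

Definition normal N : Prop :=
  is_subgroup N /\ forall g x, N x -> N (mul (inv g) (mul x g)).

Definition setprod H N : G -> Prop :=
  fun x => exists h y, H h /\ N y /\ x = mul h y.

Lemma setprod_subl H N : is_subgroup N -> subset H (setprod H N).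
Proof.
  intros HN x Hx. exists x, one. repeat split; trivial; [apply HN | now grp].
Qed.

Lemma setprod_subr H N : is_subgroup H -> subset N (setprod H N).
Proof.
  intros HH x Hx. exists one, x. repeat split; trivial; [apply HH | now grp].
Qed.

Lemma setprod_subset H N T :
  is_subgroup T -> subset H T -> subset N T -> subset (setprod H N) T.
Proof. intros HT s1 s2 x (h & y & Hh & Hy & ->). apply HT; auto. Qed.

Lemma subgroup_setprod H N :
  is_subgroup H -> normal N -> is_subgroup (setprod H N).
Proof.
  intros HH [HN nN]. split; [|split].
  - exists one, one. repeat split; [apply HH | apply HN | now grp].
  - intros ? ? (h & y & Hh & Hy & ->) (h' & y' & Hh' & Hy' & ->).
    exists (mul h h'), (mul (mul (inv h') (mul y h')) y').
    repeat split; [now apply HH | apply HN; auto | now grp].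
  - intros ? (h & y & Hh & Hy & ->).
    exists (inv h), (mul (inv (inv h)) (mul (inv y) (inv h))).
    repeat split; [now apply HH | apply nN; now apply HN | now grp].
Qed.

(** * Indices *)

Definition independent K H (n : nat) (f : nat -> G) : Prop :=
  (forall i, i < n -> K (f i)) /\
  (forall i j, i < n -> j < n -> H (mul (inv (f i)) (f j)) -> i = j).

Definition index_le K H (m : nat) : Prop :=
  forall n f, independent K H n f -> n <= m.

(** Families indexed by numbers are easier to extend and multiply than lists of representatives. *)
Lemma index_inP K H n :
  index_in K H n <->
  exists f, independent K H n f /\
    forall x, K x -> exists i, i < n /\ H (mul (inv (f i)) x).
Proof.
  split.
  - intros (l & Hl & HK & Hc & Hi). exists (fun i => nth i l one).
    split; [split|]; trivial.
    + intros i Hlt. apply HK, nth_In. lia.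
    + intros x Hx. destruct (Hc x Hx) as (g & Hg & Hgx).
      destruct (In_nth _ _ one Hg) as (i & Hlt & <-).
      exists i. split; [lia | trivial].
  - intros (f & [HK Hi] & Hc).
    assert (E : forall i, i < n -> nth i (map f (seq 0 n)) one = f i).
    (* [map_nth] wants a default that is a value of [f], so [f 0] replaces [one]. *)
    { intros i Hlt. rewrite nth_indep with (d' := f 0).
      - now rewrite map_nth, seq_nth.
      - now rewrite length_map, length_seq. }
    exists (map f (seq 0 n)). split; [|split; [|split]].
    + now rewrite length_map, length_seq.
    + intros g Hg. apply in_map_iff in Hg. destruct Hg as (i & <- & Hi').
      apply in_seq in Hi'. apply HK. lia.
    + intros x Hx. destruct (Hc x Hx) as (i & Hlt & Hx').
      exists (f i). split; trivial. apply in_map, in_seq. lia.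
    + intros i j Hlt Hjt. rewrite !E by trivial. now apply Hi.
Qed.

Lemma pigeonhole (n m : nat) (h : nat -> nat) :
  (forall i, i < n -> h i < m) ->
  (forall i j, i < n -> j < n -> h i = h j -> i = j) -> n <= m.
Proof.
  intros Hm Hinj.
  rewrite <- (length_seq n 0), <- (length_seq m 0), <- (length_map h (seq 0 n)).
  apply NoDup_incl_length.
  - apply NoDup_map_NoDup_ForallPairs; [|apply seq_NoDup].
    intros i j Hi Hj. apply in_seq in Hi, Hj. apply Hinj; lia.
  - intros y Hy. apply in_map_iff in Hy. destruct Hy as (i & <- & Hi).
    apply in_seq in Hi. apply in_seq. specialize (Hm i). lia.
Qed.

Lemma same_coset H g x y :
  is_subgroup H -> H (mul (inv g) x) -> H (mul (inv g) y) ->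
  H (mul (inv x) y).
Proof.
  intros HH Hx Hy.
  replace (mul (inv x) y) with (mul (inv (mul (inv g) x)) (mul (inv g) y))
    by now grp.
  apply HH; trivial. now apply HH.
Qed.

(** Send each member of an independent family to a covering coset that contains it; members with the
    same image lie in one coset, so this map is injective. *)
Lemma cover_index_le K H m (f : nat -> G) :
  is_subgroup H ->
  (forall x, K x -> exists i, i < m /\ H (mul (inv (f i)) x)) ->
  index_le K H m.
Proof.
  intros HH Hc n e [HK Hi].
  pose (h := fun i => epsilon (inhabits 0)
    (fun j => j < m /\ H (mul (inv (f j)) (e i)))).
  assert (Hh : forall i, i < n -> h i < m /\ H (mul (inv (f (h i))) (e i))).
  { intros i Hlt. apply epsilon_spec. apply Hc. now apply HK. }
  apply (pigeonhole n m h).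
  - intros i Hlt. now apply Hh.
  - intros i j Hli Hlj E. apply Hi; trivial.
    apply same_coset with (f (h i)); trivial.
    + now apply Hh.
    + rewrite E. now apply Hh.
Qed.

Lemma index_in_le K H n : is_subgroup H -> index_in K H n -> index_le K H n.
Proof.
  intros HH Hn. apply index_inP in Hn. destruct Hn as (f & _ & Hc).
  now apply cover_index_le with f.
Qed.

Lemma index_le_in K H m :
  is_subgroup H -> index_le K H m -> exists n, n <= m /\ index_in K H n.
Proof.
  intros HH Hm.
  (* a maximal independent family covers [K] *)
  assert (Hmax : forall k n f, m - n <= k -> independent K H n f ->
    exists n', n' <= m /\ index_in K H n').
  { induction k as [|k IH]; intros n f Hk Hf.
    all: destruct (classic (forall x, K x ->
           exists i, i < n /\ H (mul (inv (f i)) x))) as [Hc|Hc].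
    1,3: exists n; split; [now apply (Hm n f) | apply index_inP; now exists f].
    all: apply not_all_ex_not in Hc; destruct Hc as [x Hx];
      apply imply_to_and in Hx; destruct Hx as [Kx Hx].
    all: assert (Hf' : independent K H (S n)
           (fun i => if Nat.eq_dec i n then x else f i)).
    1,3: destruct Hf as [HK Hi]; split.
    1,3: intros i Hlt; destruct (Nat.eq_dec i n); trivial; apply HK; lia.
    1,2: intros i j Hli Hlj; destruct (Nat.eq_dec i n) as [->|ni];
      destruct (Nat.eq_dec j n) as [->|nj]; trivial; intro E.
    1,4: exfalso; apply Hx; exists j; split; [lia|];
      replace (mul (inv (f j)) x) with (inv (mul (inv x) (f j))) by (now grp);
      now apply HH.
    1,3: exfalso; apply Hx; exists i; split; [lia|trivial].
    1,2: apply Hi; trivial; lia.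
    (* With [k = 0] the family already has at least [m] members, so the longer one violates the
       bound. *)
    - apply Hm in Hf'. lia.
    - apply (IH (S n) _) in Hf'; trivial. lia. }
  apply (Hmax m 0 (fun _ => one)); [lia|].
  split; intros; lia.
Qed.

(** Quotients of members of [P] stay in [P], where [H] implies [L]; hence independence modulo [L]
    gives independence modulo [H]. *)
Lemma index_le_mono K H L P m :
  is_subgroup P -> subset P K -> (forall x, P x -> H x -> L x) ->
  index_le K H m -> index_le P L m.
Proof.
  intros HP s HL Hm n f [Hf Hi]. apply (Hm n f). split; [auto|].
  intros i j Hli Hlj E. apply Hi; trivial. apply HL; trivial.
  apply HP; [apply HP|]; auto.
Qed.

Lemma index_in_unique K H n m :
  is_subgroup H -> index_in K H n -> index_in K H m -> n = m.
Proof.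
  intros HH Hn Hm. apply Nat.le_antisymm.
  - apply index_inP in Hn. destruct Hn as (f & Hf & _).
    now apply (index_in_le _ _ _ HH Hm n f).
  - apply index_inP in Hm. destruct Hm as (f & Hf & _).
    now apply (index_in_le _ _ _ HH Hn m f).
Qed.

Lemma index_in_pos K H n : K one -> index_in K H n -> 0 < n.
Proof.
  intros K1 Hn. apply index_inP in Hn. destruct Hn as (f & _ & Hc).
  destruct (Hc one K1) as (i & Hi & _). lia.
Qed.

(** The products of the two transversals form a transversal, numbered by quotient and remainder
    modulo [b]. *)
Lemma index_in_mul K H L a b :
  is_subgroup K -> is_subgroup H -> subset H K -> subset L H ->
  index_in K H a -> index_in H L b -> index_in K L (a * b).
Proof.
  intros HK HH sHK sLH Ha Hb.
  assert (b0 : 0 < b) by (apply index_in_pos in Hb; trivial; apply HH).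
  apply index_inP in Ha, Hb. apply index_inP.
  destruct Ha as (f & [fK fi] & fc), Hb as (e & [eH ei] & ec).
  assert (Hq : forall i, i < a * b -> i / b < a).
  { intros i Hi. apply Nat.Div0.div_lt_upper_bound. lia. }
  assert (Hr : forall i, i mod b < b) by (intro; apply Nat.mod_upper_bound; lia).
  exists (fun i => mul (f (i / b)) (e (i mod b))). split; [split|].
  - intros i Hi. apply HK; auto.
  - intros i j Hi Hj E.
    assert (Eq : i / b = j / b).
    { apply fi; auto. apply sLH in E. revert E. grp. intro E.
      replace (mul (inv (f (i / b))) (f (j / b)))
        with (mul (mul (e (i mod b)) (mul (inv (e (i mod b)))
               (mul (inv (f (i / b))) (mul (f (j / b)) (e (j mod b))))))
               (inv (e (j mod b)))) by now grp.
      apply HH; [apply HH|apply HH]; auto. }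
    rewrite Eq in E.
    assert (Er : i mod b = j mod b).
    { apply ei; auto. revert E. now grp. }
    rewrite (Nat.div_mod_eq i b), (Nat.div_mod_eq j b). congruence.
  - intros x Hx. destruct (fc x Hx) as (i & Hi & Hxi).
    destruct (ec _ Hxi) as (j & Hj & Hxj).
    exists (i * b + j). split; [nia|].
    rewrite Nat.div_add_l, (Nat.div_small j b), Nat.add_0_r by lia.
    rewrite Nat.add_comm, Nat.Div0.mod_add, Nat.mod_small by lia.
    revert Hxj. now grp.
Qed.

(** Representatives of [H] modulo [K] still cover the product, because the factor from [N] is
    absorbed on the right. *)
Lemma index_le_setprod H K N s :
  is_subgroup K -> normal N -> index_in H K s ->
  index_le (setprod H N) (setprod K N) s.
Proof.
  intros HK HN Hs. apply index_inP in Hs. destruct Hs as (f & _ & Hc).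
  apply cover_index_le with f; [now apply subgroup_setprod|].
  intros ? (h & y & Hh & Hy & ->). destruct (Hc h Hh) as (i & Hi & Hk).
  exists i. split; trivial. exists (mul (inv (f i)) h), y.
  repeat split; trivial. now grp.
Qed.

Lemma finite_index_subset H K n :
  is_subgroup H -> is_subgroup K -> subset H K -> index H n ->
  exists m, m <= n /\ index K m.
Proof.
  intros HH HK s Hn. apply index_le_in; trivial.
  apply (index_le_mono (fun _ => True) H); auto using subgroup_full, index_in_le.
  intros x; trivial.
Qed.

Lemma index_inter_le K H P n :
  is_subgroup H -> is_subgroup K -> is_subgroup P -> subset P K ->
  index_in K H n -> exists m, m <= n /\ index_in P (fun x => P x /\ H x) m.
Proof.
  intros HH HK HP s Hn. apply index_le_in; [now apply subgroup_inter|].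
  apply (index_le_mono K H); auto using index_in_le.
Qed.

(** * Normal cores of finite index *)

Definition conj_inter T (l : list G) : G -> Prop :=
  fun x => forall g, In g l -> T (mul (inv g) (mul x g)).

Lemma subgroup_conj_inter T l : is_subgroup T -> is_subgroup (conj_inter T l).
Proof.
  intro HT. split; [|split].
  - intros g _. grp. apply HT.
  - intros x y Hx Hy g Hg.
    replace (mul (inv g) (mul (mul x y) g))
      with (mul (mul (inv g) (mul x g)) (mul (inv g) (mul y g))) by now grp.
    apply HT; auto.
  - intros x Hx g Hg.
    replace (mul (inv g) (mul (inv x) g))
      with (inv (mul (inv g) (mul x g))) by now grp.
    apply HT; auto.
Qed.

Lemma finite_index_conj_inter T l :
  is_subgroup T -> finite_index T -> finite_index (conj_inter T l).
Proof.
  intros HT [n Hn]. induction l as [|g l [m IH]].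
  - exists 1. apply index_inP. exists (fun _ => one). split; [split|]; auto.
    + intros. lia.
    + intros x _. exists 0. split; [lia|]. intros g [].
  - set (P := conj_inter T l) in *.
    set (C := fun x => T (mul (inv g) (mul x g))).
    assert (HP : is_subgroup P) by now apply subgroup_conj_inter.
    assert (HC : is_subgroup C).
    { destruct (subgroup_conj_inter T (g :: nil) HT) as (h1 & h2 & h3).
      assert (E : forall x, conj_inter T (g :: nil) x <-> C x).
      { intro x. split; [intro Hx; apply Hx; now left | intros Hx k [<-|[]]; exact Hx]. }
      repeat split; setoid_rewrite <- E; auto. }
    (* Conjugating representatives for [T] by [g] gives representatives for its conjugate [C]. *)
    assert (Cn : index_le (fun _ => True) C n).
    { apply index_inP in Hn. destruct Hn as (f & _ & Hc).
      apply cover_index_le with (fun i => mul g (mul (f i) (inv g))); trivial.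
      intros x _. destruct (Hc (mul (inv g) (mul x g)) I) as (i & Hi & E).
      exists i. split; trivial. unfold C. revert E. now grp. }
    destruct (index_le_in _ _ _ HC Cn) as (n' & _ & Hn').
    destruct (index_inter_le _ _ P n' HC subgroup_full HP) as (k & _ & Hk); trivial.
    { intros x; trivial. }
    assert (F : index (fun x => P x /\ C x) (m * k)).
    { apply (index_in_mul _ P); auto using subgroup_full.
      - intros x; trivial.
      - intros x [H _]; trivial. }
    destruct (finite_index_subset (fun x => P x /\ C x) (conj_inter T (g :: l)) (m * k))
      as (r & _ & Hr); auto using subgroup_inter, subgroup_conj_inter.
    + intros x [Hx Cx] h [<-|Hh]; auto.
    + now exists r.
Qed.

(** A conjugate of [T] depends only on the coset of the conjugating element, so finitely many
    representatives account for all conjugates. *)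
Lemma normal_core T :
  is_subgroup T -> finite_index T ->
  exists N, normal N /\ subset N T /\ finite_index N.
Proof.
  intros HT Ti. destruct (Ti) as (n & l & _ & _ & Hc & _).
  assert (all : forall x, conj_inter T l x -> forall g, T (mul (inv g) (mul x g))).
  { intros x Hx g. destruct (Hc g I) as (h & Hh & E). specialize (Hx h Hh).
    replace (mul (inv g) (mul x g)) with
      (mul (inv (mul (inv h) g)) (mul (mul (inv h) (mul x h)) (mul (inv h) g)))
      by now grp.
    apply HT; [now apply HT|]. now apply HT. }
  exists (conj_inter T l). split; [split|split].
  - now apply subgroup_conj_inter.
  - intros g x Hx h _.
    generalize (all x Hx (mul g h)). now grp.
  - intros x Hx. generalize (all x Hx one). now grp.
  - now apply finite_index_conj_inter.
Qed.

(** * Schreier's lemma *)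

(** The generators of [H] are the Schreier elements [c s g], with [s] in [l] and [g] in the
    transversal [t]. *)
Lemma schreier K H m (l : list G) :
  is_subgroup K -> is_subgroup H -> subset H K ->
  generated_by K l -> index_in K H m ->
  exists l', length l' = m * length l /\ generated_by H l'.
Proof.
  intros HK HH sHK Hl (t & Ht & tK & tc & _).
  (* [Q x] depends only on the coset of [x], so [epsilon] picks one representative per coset; that
     of [H] itself is forced to be [one]. *)
  pose (Q := fun x r => H (mul (inv r) x) /\ (H x -> r = one)).
  pose (rep := fun x => epsilon (inhabits one) (Q x)).
  assert (repQ : forall x, Q x (rep x)).
  { intro x. apply epsilon_spec. destruct (classic (H x)) as [Hx|Hx].
    - exists one. split; trivial. now grp.
    - exists x. split; [|now intro]. grp. apply HH. }
  assert (rep_eq : forall x y, H (mul (inv x) y) -> rep x = rep y).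
  { intros x y Hxy. unfold rep. f_equal. extensionality r.
    assert (HK1 : forall u v, H (mul (inv u) v) -> H u -> H v).
    { intros u v Huv Hu. rewrite <- (mulVKg u v). now apply HH. }
    assert (Hyx : H (mul (inv y) x)).
    { replace (mul (inv y) x) with (inv (mul (inv x) y)) by now grp.
      now apply HH. }
    assert (HKr : forall u v, H (mul (inv u) v) -> H (mul (inv r) u) ->
              H (mul (inv r) v)).
    { intros u v Huv Hu.
      replace (mul (inv r) v) with (mul (mul (inv r) u) (mul (inv u) v))
        by now grp.
      now apply HH. }
    apply propositional_extensionality; split; intros [q1 q2]; split; eauto. }
  (* A cocycle: [c (x y) g] is [c x (y g)] times [c y g]. Also [c x one] is [x] for [x] in [H]. *)
  pose (c := fun x g => mul (inv (rep (mul x g))) (mul x (rep g))).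
  assert (cH : forall x g, H (c x g)).
  { intros x g. unfold c.
    replace (mul (inv (rep (mul x g))) (mul x (rep g))) with
      (mul (mul (inv (rep (mul x g))) (mul x g)) (inv (mul (inv (rep g)) g)))
      by now grp.
    apply HH; [apply repQ|]. apply HH, repQ. }
  pose (l' := flat_map (fun g => map (fun x => c x g) l) t).
  exists l'. split.
  - subst l' m. clear. induction t as [|g t IH]; simpl; trivial.
    now rewrite length_app, length_map, IH.
  - assert (Hgen : forall x, K x -> forall g, K g ->
      gen (fun y => In y l') (c x g)).
    { destruct (subgroup_gen (fun y => In y l')) as (g1 & g2 & g3).
      intros x Kx. apply Hl in Kx.
      (* By the cocycle rule this predicate is a subgroup, so only the generators in [l] need
         checking. For them, [g] may be moved to its representative in [t]. *)
      apply (Kx (fun x => K x /\ forall g, K g -> gen (fun y => In y l') (c x g))).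
      - split; [|split].
        + split; [apply HK|]. intros g _. unfold c. now grp.
        + intros y z [Ky Hy] [Kz Hz]. split; [now apply HK|]. intros g Kg.
          replace (c (mul y z) g) with (mul (c y (mul z g)) (c z g))
            by (unfold c; now grp).
          apply g2; auto. apply Hy. now apply HK.
        + intros y [Ky Hy]. split; [now apply HK|]. intros g Kg.
          replace (c (inv y) g) with (inv (c y (mul (inv y) g)))
            by (unfold c; now grp).
          apply g3, Hy. apply HK; trivial. now apply HK.
      - intros s Hs. split; [apply Hl, subset_gen, Hs|]. intros g Kg.
        destruct (tc g Kg) as (h & Hh & E).
        replace (c s g) with (c s h).
        + apply subset_gen, in_flat_map. exists h. split; trivial.
          now apply (in_map (fun x => c x h)).
        + unfold c. rewrite (rep_eq h g), (rep_eq (mul s h) (mul s g)); trivial.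
          now grp. }
    intro x. split.
    + intro Hx. replace x with (c x one).
      * apply Hgen; [now apply sHK | apply HK].
      * unfold c. rewrite mulg1.
        rewrite (proj2 (repQ x) Hx), (proj2 (repQ one)); [now grp | apply HH].
    + intro Hx. apply Hx; trivial. intros y Hy.
      apply in_flat_map in Hy. destruct Hy as (g & _ & Hy).
      apply in_map_iff in Hy. destruct Hy as (s & <- & _). apply cH.
Qed.

End Subgroups.

(** * Rank gradient *)

Lemma rank_exists (G : group) (H : G -> Prop) (l : list G) :
  generated_by H l -> exists d, d <= length l /\ rank H d.
Proof.
  remember (length l) as n eqn:E. revert l E.
  induction n as [n IH] using lt_wf_ind. intros l E Hl.
  destruct (classic (exists l', generated_by H l' /\ length l' < n))
    as [(l' & Hl' & lt)|min].
  - destruct (IH _ lt l' eq_refl Hl') as (d & Hd & Hr). exists d. split; [lia|trivial].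
  - exists n. split; [lia|]. split; [now exists l|].
    intros l' Hl'. destruct (le_lt_dec n (length l')); trivial.
    exfalso. apply min. now exists l'.
Qed.

(** With [1/q] below [eps], the inequality [eps * n <= d - 1] gives [n < q * d]; this moves the
    hypothesis from reals to natural numbers. *)
Lemma rank_gradient_bound (G : group) :
  rank_gradient_pos G ->
  exists q : nat, forall (W : G -> Prop) n l,
    is_subgroup W -> index W n -> generated_by W l -> n < q * length l.
Proof.
  intros (eps & e0 & He).
  destruct (archimed_cor1 eps e0) as (q & Hq & q0).
  exists q. intros W n l HW Hn Hl.
  destruct (rank_exists _ _ _ Hl) as (d & Hd & Hr).
  specialize (He W n d HW Hn Hr).
  assert (n0 : 0 < n) by now apply index_in_pos in Hn.
  apply lt_0_INR in n0. apply lt_0_INR in q0. apply le_INR in Hd.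
  apply INR_lt. rewrite mult_INR.
  apply (Rmult_le_compat_r (INR n)) in He; [|lra].
  replace ((INR d - 1) / INR n * INR n)%R with (INR d - 1)%R in He by (field; lra).
  assert (H1 : (1 < INR q * eps)%R).
  { apply (Rmult_lt_compat_l (INR q)) in Hq; trivial.
    rewrite Rinv_r in Hq; lra. }
  nra.
Qed.

Lemma LPF_large_index (G : group) (H : G -> Prop) (m : nat) :
  LPF G -> is_subgroup H -> fin_gen H -> ~ finite_index H ->
  exists U n, is_subgroup U /\ subset H U /\ index U n /\ m <= n.
Proof. intros HG HH Hf Hi. exact (proj1 (HG H HH Hf None) Hi m). Qed.

(** * Construction of the finite index subgroup of [B] *)

Theorem theorem3p4 (G : group)
  (HGfg : fin_gen (fun _ : G => True))
  (HLPF : LPF G)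
  (Hrg : rank_gradient_pos G)
  (A B : G -> Prop)
  (HA : is_subgroup A) (HB : is_subgroup B)
  (HAfg : fin_gen A) (HBfg : fin_gen B)
  (HAinf : ~ finite_index A) (HBinf : ~ finite_index B) :
  exists B0 : G -> Prop,
    is_subgroup B0 /\ subset B0 B /\ finite_index_in B B0 /\
    ~ finite_index (gen (fun x => A x \/ B0 x)).
Proof.
  destruct (rank_gradient_bound _ Hrg) as (q & Hq).
  destruct (HAfg) as (la & Hla), (HBfg) as (lb & Hlb).
  set (a := length la) in *. set (b := length lb) in *.
  (* The factor 2 leaves each of the two generator counts below at most half of the index of [D]. *)
  destruct (LPF_large_index G A (2 * q * a)) as (U & n & HU & sAU & Un & nbig); trivial.
  destruct (LPF_large_index G B (2 * q * b)) as (V & k & HV & sBV & Vk & kbig); trivial.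
  assert (subT : forall P : G -> Prop, subset P (fun _ => True)) by now intros P x.
  destruct (index_inter_le _ _ U k HV subgroup_full HU (subT U) Vk) as (u & _ & Hu).
  destruct (index_inter_le _ _ V n HU subgroup_full HV (subT V) Un) as (v & _ & Hv).
  set (D := fun x => U x /\ V x) in *.
  assert (HD : is_subgroup D) by now apply subgroup_inter.
  assert (Hv' : index_in V D v).
  { replace D with (fun x => V x /\ U x); trivial.
    extensionality x. apply propositional_extensionality. unfold D. tauto. }
  assert (Du : index D (n * u)).
  { apply (index_in_mul _ U); trivial using subgroup_full. now intros x []. }
  assert (Dv : index D (k * v)).
  { apply (index_in_mul _ V); trivial using subgroup_full. now intros x []. }
  assert (nukv : n * u = k * v) by (apply (index_in_unique _ D _ _ HD Du Dv)).
  (* This [B0] is intermediate; the final witness is its subgroup [B1]. *)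
  set (A0 := fun x => A x /\ V x). set (B0 := fun x => B x /\ U x).
  assert (HA0 : is_subgroup A0) by now apply subgroup_inter.
  assert (HB0 : is_subgroup B0) by now apply subgroup_inter.
  assert (sA0A : subset A0 A) by now intros x [].
  assert (sB0B : subset B0 B) by now intros x [].
  assert (As : exists s, s <= u /\ index_in A A0 s).
  { apply index_le_in; trivial. apply (index_le_mono U D); auto using index_in_le.
    intros x Ax [_ Vx]. now split. }
  assert (Bt : exists t, t <= v /\ index_in B B0 t).
  { apply index_le_in; trivial. apply (index_le_mono V D); auto using index_in_le.
    intros x Bx [Ux _]. now split. }
  destruct As as (s & su & As), Bt as (t & tv & Bt).
  destruct (schreier _ _ _ _ HA HA0 sA0A Hla As) as (la0 & Ela0 & Hla0).
  destruct (schreier _ _ _ _ HB HB0 sB0B Hlb Bt) as (lb0 & Elb0 & Hlb0).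
  set (C := gen (fun x => A0 x \/ B0 x)).
  assert (HC : is_subgroup C) by apply subgroup_gen.
  assert (Cgen : generated_by C (la0 ++ lb0)) by now apply gen_union_generated_by.
  (* A finite index of [C] would be less than [q (s a + t b) <= q u a + q v b <= n u], yet at least
     the index [n u] of [D], which contains [C]. *)
  assert (Cinf : ~ finite_index C).
  { intros [c Cc].
    destruct (finite_index_subset C D c HC HD) as (c' & cc' & Dc'); trivial.
    { intros x Cx. apply Cx; trivial.
      intros y [[Ay Vy]|[By Uy]]; split; auto. }
    pose proof (index_in_unique _ D _ _ HD Du Dc').
    specialize (Hq C c _ HC Cc Cgen).
    rewrite length_app, Ela0, Elb0 in Hq. fold a b in Hq.
    assert (s * a <= u * a) by now apply Nat.mul_le_mono_r.
    assert (t * b <= v * b) by now apply Nat.mul_le_mono_r.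
    nia. }
  (* The factor [s] pays for the index of [U0] in [U1], and [a + t * b] for the generators of the
     final subgroup. *)
  destruct (LPF_large_index G C (2 * q * s * (a + t * b) + 1))
    as (T & M & HT & sCT & TM & Mbig); trivial.
  { now exists (la0 ++ lb0). }
  destruct (normal_core T HT) as (N & nN & sNT & [p Np]); [now exists M|].
  set (U0 := setprod A0 N). set (U1 := setprod A N).
  assert (HU0 : is_subgroup U0) by now apply subgroup_setprod.
  assert (HU1 : is_subgroup U1) by now apply subgroup_setprod.
  assert (sU01 : subset U0 U1).
  { intros x (h & y & Hh & Hy & ->). exists h, y. auto. }
  assert (sU0T : subset U0 T).
  { apply setprod_subset; trivial. intros x Hx. apply sCT, subset_gen. now left. }
  destruct (finite_index_subset N U1 p (proj1 nN) HU1) as (n1 & _ & U1n); trivial.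
  { now apply setprod_subr. }
  destruct (index_le_in U1 U0 s HU0) as (s' & ss' & U01s).
  { now apply index_le_setprod. }
  assert (U0n : index U0 (n1 * s')).
  { now apply (index_in_mul _ U1 _ _ _ subgroup_full). }
  assert (Tt : exists r, r <= n1 * s' /\ index_in T U0 r).
  { apply index_le_in; trivial.
    apply (index_le_mono (fun _ => True) U0); auto using index_in_le. }
  destruct Tt as (r & _ & Tr).
  (* The index of [U0] in [G], computed through [T] and through [U1]. *)
  assert (EM : M * r = n1 * s').
  { apply (index_in_unique (fun _ => True) U0); trivial.
    now apply (index_in_mul _ T _ _ _ subgroup_full). }
  assert (r0 : 0 < r) by (apply index_in_pos in Tr; trivial; apply HT).
  (* Since [B0] lies in [C] and hence in [T], cutting it by [U0] costs at most [r]. *)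
  destruct (index_inter_le T U0 B0 r) as (r' & rr' & B1r); trivial.
  { intros x Hx. apply sCT, subset_gen. now right. }
  set (B1 := fun x => B0 x /\ U0 x) in *.
  assert (HB1 : is_subgroup B1) by now apply subgroup_inter.
  assert (sB1B0 : subset B1 B0) by now intros x [].
  assert (sB1B : subset B1 B) by (intros x Hx; auto).
  assert (B1i : index_in B B1 (t * r')) by now apply (index_in_mul _ B0).
  exists B1. split; [trivial|split; [trivial|split; [now exists (t * r')|]]].
  intros [w Ww].
  destruct (schreier _ _ _ _ HB HB1 sB1B Hlb B1i) as (lb1 & Elb1 & Hlb1).
  pose proof (gen_union_generated_by _ _ _ _ Hla Hlb1) as Wgen.
  pose proof (Hq _ _ _ (subgroup_gen _) Ww Wgen) as Wq.
  rewrite length_app, Elb1 in Wq. fold a b in Wq.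
  (* Both [A] and [B1] lie in [U1], so the supposed index [w] is at least [n1]. *)
  destruct (finite_index_subset (gen (fun x => A x \/ B1 x)) U1 w)
    as (w' & ww' & U1w); trivial using subgroup_gen.
  { intros x Hx. apply Hx; trivial. intros y [Ay|By].
    - now apply setprod_subl; [apply nN|].
    - apply sU01, By. }
  pose proof (index_in_unique _ U1 _ _ HU1 U1n U1w).
  assert (t * r' * b <= t * b * r) by nia.
  assert (n1 * s' <= n1 * s) by nia.
  assert (s0 : 0 < s) by (apply index_in_pos in As; trivial; apply HA).
  (* From the size of [M] and [M * r = n1 * s' <= n1 * s]; cancelling [s] bounds [n1] from below. *)
  assert (e1 : 2 * q * s * (a + t * b) * r <= n1 * s) by nia.
  assert (e2 : 2 * q * (a + t * b) * r <= n1).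
  { apply (Nat.mul_le_mono_pos_r _ _ s); trivial. lia. }
  (* Here [a <= a * r] because [r] is positive. Together with [e2] this contradicts
     [n1 <= w < q * (a + t * r' * b)]. *)
  assert (e3 : q * (a + t * r' * b) <= q * (a + t * b) * r).
  { rewrite <- (Nat.mul_assoc q (a + t * b)). apply Nat.mul_le_mono_l. nia. }
  lia.
Qed.
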